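(* There is an absolute constant $C>0$ such that for every connected finite undirected unweighted graph $G$ with $m$ edges, the competitive ratio of electric routing satisfies $\eta_{\mathcal{E}}\le C\,m^{1/2}$. Furthermore, there exist a constant $c>0$ and an infinite family of connected unweighted graphs $G_k$ with $m_k\to\infty$ edges such that $\eta_{\mathcal{E}}(G_k)\ge c\,m_k^{1/2}$ (witnessed by suitable demand sets).
   Context: Let $G=(V,E)$, $V=\{1,\dots,n\}$, with all edge weights $1$. Fix an arbitrary orientation of each edge. The discrete gradient $B\in\mathbb{R}^{E\times V}$ has, for an edge $e$ oriented $u\to v$, row $e$ equal to $\chi_u-\chi_v$ ($\chi_x$ the indicator vector of $x$). Let $W=I$ be the diagonal edge-weight matrix, $L=B^{T}WB$ the Laplacian and $L^{\dagger}$ its Moore–Penrose pseudoinverse. A single-commodity demand is $d=a(\chi_s-\chi_t)$ with $a>0$, $s\neq t$; a flow $f\in\mathbb{R}^E$ routes $d$ if $B^{T}f=d$. A demand set is a finite family $(d_\tau)_\tau$ of such demands, routed by a multi-commodity flow $(f_\tau)_\tau$ if $B^{T}f_\tau=d_\tau$ for all $\tau$. Congestion: $\|(f_\tau)_\tau\|_G:=\max_{e}\sum_\tau|f_{\tau,e}|/w_e$. Electric routing: $\mathcal{E}(d):=WBL^{\dagger}d$, applied to each demand separately. Competitive ratio: $\eta_{\mathcal{E}}:=\sup_{(d_\tau)}\sup_{(f_\tau):B^{T}f_\tau=d_\tau}\|(\mathcal{E}(d_\tau))_\tau\|_G/\|(f_\tau)_\tau\|_G$. *)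

(* Defs.v *)
From HB Require Import structures.
From mathcomp Require Import all_boot all_order all_algebra.
From mathcomp Require Import all_classical all_reals all_analysis.
Set Implicit Arguments.
Unset Strict Implicit.
Unset Printing Implicit Defensive.
Import Order.TTheory GRing.Theory Num.Theory.
Local Open Scope classical_set_scope.
Local Open Scope ring_scope.

(* Finite simple graph on the vertex set 'I_(nv G); an edge is an unordered
   pair of distinct vertices. *)
Record graph := Graph {
  nv : nat;
  edges : {set {set 'I_nv}};
  card_edge : forall e : {set 'I_nv}, e \in edges -> #|e| = 2%N
}.

Definition adj (G : graph) : rel 'I_(nv G) :=
  fun u v => [set u; v]%SET \in edges G.

Definition connected_graph (G : graph) : Prop :=
  (0 < nv G)%N /\ forall u v : 'I_(nv G), connect (@adj G) u v.

Definition nedges (G : graph) : nat := #|edges G|.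

(* Edges are numbered by 'I_(nedges G) through enum_val, and the e-th edge is
   oriented src e -> tgt e. *)
Record orientation (G : graph) := Orientation {
  src : 'I_(nedges G) -> 'I_(nv G);
  tgt : 'I_(nedges G) -> 'I_(nv G);
  src_tgtE : forall e : 'I_(nedges G),
    enum_val e = [set src e; tgt e]%SET :> {set 'I_(nv G)}
}.

Section PseudoInverse.
Variable R : realType.

(* The four Penrose equations, for real matrices. *)
Definition is_pseudoinverse (m n : nat) (A : 'M[R]_(m, n)) (X : 'M[R]_(n, m)) :
    Prop :=
  [/\ A *m X *m A = A, X *m A *m X = X,
      (A *m X)^T = A *m X & (X *m A)^T = X *m A].

(* The Moore-Penrose pseudoinverse; the default value 0 is never used, see
   [pseudoinverseP] and [pseudoinverse_unique]. *)
Definition pseudoinverse (m n : nat) (A : 'M[R]_(m, n)) : 'M[R]_(n, m) :=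
  xget 0 [set X | is_pseudoinverse A X].

Lemma is_pseudoinverse_inj (m n : nat) (A : 'M[R]_(m, n)) X Y :
  is_pseudoinverse A X -> is_pseudoinverse A Y -> X = Y.
Proof.
move=> [X1 X2 X3 X4] [Y1 Y2 Y3 Y4].
have EA : A *m X = A *m Y.
  have E : A *m X = (A *m Y) *m (A *m X) by rewrite mulmxA Y1.
  by rewrite -X3 E trmx_mul X3 Y3 mulmxA X1.
have EB : X *m A = Y *m A.
  have E : X *m A = (X *m A) *m (Y *m A) by rewrite -mulmxA (mulmxA A) Y1.
  by rewrite -X4 E trmx_mul X4 Y4 -mulmxA (mulmxA A) X1.
by rewrite -X2 -mulmxA EA mulmxA EB Y2.
Qed.

Lemma mulmx_tr_eq0 (m n : nat) (A : 'M[R]_(m, n)) : A *m A^T = 0 -> A = 0.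
Proof.
move=> A0; apply/matrixP=> i j; rewrite mxE.
have /eqP : (A *m A^T) i i = 0 by rewrite A0 mxE.
rewrite mxE psumr_eq0 => [/allP /(_ j)|k _]; last by rewrite mxE -expr2 sqr_ge0.
by rewrite mem_index_enum mxE mulf_eq0 orbb => /(_ isT) /eqP.
Qed.

Lemma gram_unitmx (m n : nat) (A : 'M[R]_(m, n)) :
  row_free A -> A *m A^T \in unitmx.
Proof.
move=> fA; rewrite -row_free_unit -kermx_eq0; apply/eqP.
set K := kermx _.
have K0 : K *m (A *m A^T) = 0 by rewrite mulmx_ker.
have KA : K *m A = 0.
  by apply: mulmx_tr_eq0; rewrite trmx_mul mulmxA -(mulmxA K) K0 mul0mx.
by apply: (row_free_inj fA); rewrite KA mul0mx.
Qed.

Lemma pseudoinverse_ex (m n : nat) (A : 'M[R]_(m, n)) :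
  exists X, is_pseudoinverse A X.
Proof.
have := mulmx_base A; have := row_base_free A; have := col_base_full A.
move: (col_base A) (row_base A) => C F fC fF AE.
clear -AE fC fF; move: (\rank A) C F fC fF AE => r C F fC fF <-.
have uF : F *m F^T \in unitmx by apply/gram_unitmx.
have uC : C^T *m C \in unitmx.
  rewrite -{2}[C]trmxK; apply: gram_unitmx.
  by rewrite /row_free mxrank_tr.
have sF : (F *m F^T)^T = F *m F^T by rewrite trmx_mul trmxK.
have sC : (C^T *m C)^T = C^T *m C by rewrite trmx_mul trmxK.
pose Y := F^T *m invmx (F *m F^T).
pose Z := invmx (C^T *m C) *m C^T.
have FY : F *m Y = 1%:M by rewrite mulmxA mulmxV.
have ZC : Z *m C = 1%:M by rewrite -mulmxA mulVmx.
have AX : C *m F *m (Y *m Z) = C *m Z.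
  by rewrite -mulmxA (mulmxA F) FY mul1mx.
have XA : (Y *m Z) *m (C *m F) = Y *m F.
  by rewrite -mulmxA (mulmxA Z) ZC mul1mx.
exists (Y *m Z); split.
- by rewrite AX -mulmxA (mulmxA Z) ZC mul1mx.
- by rewrite XA -mulmxA (mulmxA F) FY mul1mx.
- by rewrite AX !trmx_mul trmxK trmx_inv sC mulmxA.
- by rewrite XA !trmx_mul trmxK trmx_inv sF -mulmxA.
Qed.

Lemma pseudoinverseP (m n : nat) (A : 'M[R]_(m, n)) :
  is_pseudoinverse A (pseudoinverse A).
Proof. by have [X AX] := pseudoinverse_ex A; exact: (xgetI 0 AX). Qed.

Lemma pseudoinverse_unique (m n : nat) (A : 'M[R]_(m, n)) X :
  is_pseudoinverse A X -> pseudoinverse A = X.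
Proof. by move=> AX; apply: (is_pseudoinverse_inj _ AX); exact: pseudoinverseP. Qed.

End PseudoInverse.

Section ElectricRouting.
Variables (R : realType) (G : graph) (o : orientation G).

Local Notation vertex_vec := 'cV[R]_(nv G).
Local Notation flow := 'cV[R]_(nedges G).

Definition chi (x : 'I_(nv G)) : vertex_vec := delta_mx x 0.

Definition gradient : 'M[R]_(nedges G, nv G) :=
  \matrix_e (chi (src o e) - chi (tgt o e))^T.

Definition weights : 'M[R]_(nedges G) := 1%:M.

Definition laplacian : 'M[R]_(nv G) := gradient^T *m weights *m gradient.

Definition electric_routing (d : vertex_vec) : flow :=
  weights *m gradient *m pseudoinverse laplacian *m d.

Definition is_demand (d : vertex_vec) : Prop :=
  exists (a : R) (s t : 'I_(nv G)), [/\ 0 < a, s != t & d = a *: (chi s - chi t)].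

Definition is_demand_set (k : nat) (d : 'I_k -> vertex_vec) : Prop :=
  forall i, is_demand (d i).

Definition routes (k : nat) (f : 'I_k -> flow) (d : 'I_k -> vertex_vec) : Prop :=
  forall i, gradient^T *m f i = d i.

Definition congestion (k : nat) (f : 'I_k -> flow) : R :=
  \big[Num.max/0]_(e < nedges G) \sum_(i < k) (`|f i e 0| / weights e e).

(* Only the empty demand set has routings of congestion 0, namely the empty
   flow; there the ratio is 0 / 0 = 0, which does not affect the supremum. *)
Definition competitive_ratio_at (k : nat) (d : 'I_k -> vertex_vec) : \bar R :=
  ereal_sup [set (congestion (fun i => electric_routing (d i))
                    / congestion f)%:E | f in [set f | routes f d]].

Definition competitive_ratio : \bar R :=
  ereal_sup [set r | exists (k : nat) (d : 'I_k -> vertex_vec),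
    is_demand_set d /\ r = competitive_ratio_at d].

End ElectricRouting.

(* Main.v *)
(* Electric routing sends a flow [f] to [P f], where [P := B L^+ B^T] is an
   orthogonal projection of the edge space. The load on [e] is thus at most the
   congestion of the original flow times the l1 norm of row [e] of [P], and this
   row has l2 norm at most 1, hence l1 norm at most [sqrt m].
   Conversely, join the ends of an edge [e0] by [K] parallel paths of [K + 1]
   edges each. A unit current across [e0] sends a constant fraction of itself
   through the paths, so row [e0] of [P] has l1 norm of order [K], that is, of
   order [sqrt m]; unit demands across all edges realise this norm. *)
Require Import Defs.
From HB Require Import structures.
From mathcomp Require Import all_boot all_order all_algebra.
From mathcomp Require Import all_classical all_reals all_analysis.
From mathcomp Require Import zify ring lra.
Set Implicit Arguments.
Unset Strict Implicit.
Unset Printing Implicit Defensive.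
Import Order.TTheory GRing.Theory Num.Theory.
Local Open Scope classical_set_scope.
Local Open Scope ring_scope.

(** * The electric projection and the upper bound *)

Lemma pseudoinverse_tr (R : realType) m n (A : 'M[R]_(m, n)) :
  pseudoinverse A^T = (pseudoinverse A)^T.
Proof.
have [p1 p2 p3 p4] := pseudoinverseP A; apply: pseudoinverse_unique; split.
- by rewrite -[RHS](congr1 trmx p1) !trmx_mul mulmxA.
- by rewrite -[RHS](congr1 trmx p2) !trmx_mul mulmxA.
- by rewrite -trmx_mul p4.
- by rewrite -trmx_mul p3.
Qed.

Section Projection.
Variables (R : realType) (G : graph) (o : orientation G).
Local Notation B := (gradient R o).
Local Notation L := (laplacian R o).
Local Notation Li := (pseudoinverse L).
Local Notation P := (B *m Li *m B^T).

Lemma laplacianE : L = B^T *m B.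
Proof. by rewrite /laplacian /weights mulmx1. Qed.

Lemma laplacian_sym : L^T = L.
Proof. by rewrite laplacianE trmx_mul trmxK. Qed.

Lemma pseudoinverse_laplacian_sym : Li^T = Li.
Proof. by rewrite -pseudoinverse_tr laplacian_sym. Qed.

(** [L] and [B^T] have the same column space, which [L *m Li] fixes. Concretely, the difference [X]
    of the two sides kills [B], and [X^T] is a combination of right multiples of [B], so
    [X *m X^T = 0]. *)
Lemma laplacian_pseudoinverse_gradient : L *m Li *m B^T = B^T.
Proof.
have [p1 _ p3 _] := pseudoinverseP L.
apply/eqP; rewrite -subr_eq0; apply/eqP/mulmx_tr_eq0.
set X := (X in X *m _); have XB : X *m B = 0.
  by rewrite mulmxBl -(mulmxA (L *m Li)) -laplacianE p1 subrr.
by rewrite [X^T]linearB /= trmx_mul trmxK mulmxBr mulmxA XB mul0mx subrr.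
Qed.

Lemma electric_routing_gradient f : electric_routing o (B^T *m f) = P *m f.
Proof. by rewrite /electric_routing /weights mul1mx !mulmxA. Qed.

Lemma electric_projection_sym : P^T = P.
Proof. by rewrite !trmx_mul trmxK pseudoinverse_laplacian_sym mulmxA. Qed.

Lemma electric_projection_idem : P *m P = P.
Proof.
have [_ p2 _ _] := pseudoinverseP L.
have -> : P *m P = B *m (Li *m (B^T *m B) *m Li) *m B^T by rewrite !mulmxA.
by rewrite -laplacianE p2.
Qed.

Lemma electric_projection_row_le e : \sum_e' `|P e e'| <= Num.sqrt (nedges G)%:R.
Proof.
set t := Num.sqrt _.
have m0 : 0 < (nedges G)%:R :> R by rewrite ltr0n (leq_ltn_trans _ (ltn_ord e)).
have t0 : 0 < t by rewrite sqrtr_gt0.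
have tt : (nedges G)%:R = t ^+ 2 by rewrite sqr_sqrtr // ltW.
(* As [P] is symmetric and idempotent, the squared l2 norm of row [e] is the diagonal entry, which
   then dominates its own square and is at most 1. *)
have E : \sum_e' P e e' ^+ 2 = P e e.
  rewrite -{2}electric_projection_idem mxE; apply: eq_bigr => i _.
  by rewrite expr2; congr (_ * _); rewrite -[in RHS]electric_projection_sym [RHS]mxE.
have P1 : P e e <= 1.
  have : P e e ^+ 2 <= P e e.
    by rewrite -{2}E (bigD1 e) //= lerDl sumr_ge0 // => i _; exact: sqr_ge0.
  by move: (P e e) => x; nra.
(* AM-GM stands in for Cauchy-Schwarz: with weight [t], the square root of the number of edges, the
   bounds sum to [(t * P e e + t) / 2 <= t]. *)
have H i : `|P e i| <= (t * P e i ^+ 2 + t^-1) / 2.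
  rewrite -(real_normK (num_real (P e i))); move: `|_| => x.
  rewrite -subr_ge0.
  have -> : (t * x ^+ 2 + t^-1) / 2 - x = (t * x - 1) ^+ 2 / (2 * t).
    by field; rewrite gt_eqF.
  by rewrite divr_ge0 ?sqr_ge0 // mulr_ge0 // ltW.
apply: le_trans (ler_sum _ (fun i _ => H i)) _.
rewrite -mulr_suml big_split /= -mulr_sumr E sumr_const card_ord -[t^-1 *+ _]mulr_natl tt.
have -> : t ^+ 2 * t^-1 = t by rewrite expr2 mulfK // gt_eqF.
nra.
Qed.

Lemma congestionE k (f : 'I_k -> 'cV[R]_(nedges G)) :
  congestion f = \big[Num.max/0]_(e < nedges G) \sum_(i < k) `|f i e 0|.
Proof.
apply: eq_bigr => e _; apply: eq_bigr => i _.
by rewrite /weights mxE eqxx divr1.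
Qed.

Lemma congestion_ge0 k (f : 'I_k -> 'cV[R]_(nedges G)) : 0 <= congestion f.
Proof. by rewrite congestionE; exact: bigmax_ge_id. Qed.

Lemma electric_congestion_le k (f : 'I_k -> 'cV[R]_(nedges G)) :
  congestion (fun i => electric_routing o (B^T *m f i)) <=
    Num.sqrt (nedges G)%:R * congestion f.
Proof.
rewrite {1}congestionE; apply: bigmax_le => [|e _].
  by rewrite mulr_ge0 ?sqrtr_ge0 ?congestion_ge0.
under eq_bigr do rewrite electric_routing_gradient mxE.
apply: (@le_trans _ _ (\sum_(i < k) \sum_e' `|P e e'| * `|f i e' 0|)).
  apply: ler_sum => i _; apply: le_trans (ler_norm_sum _ _ _) _.
  by apply: ler_sum => e' _; rewrite normrM.
rewrite exchange_big /=.
apply: le_trans (ler_wpM2r (congestion_ge0 f) (electric_projection_row_le e)).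
rewrite mulr_suml; apply: ler_sum => e' _; rewrite -mulr_sumr.
by apply: ler_wpM2l => //; rewrite congestionE; exact: le_bigmax.
Qed.

Lemma competitive_ratio_le :
  (competitive_ratio R o <= (Num.sqrt (nedges G)%:R)%:E)%E.
Proof.
apply: ge_ereal_sup => _ [k [d [_ ->]]]; apply: ge_ereal_sup => _ [f fd <-].
rewrite lee_fin; have -> : d = fun i => B^T *m f i.
  by apply/funext => i; rewrite fd.
(* At congestion 0 the quotient is 0, since the inverse of 0 is 0. *)
have := congestion_ge0 f; rewrite le_eqVlt => /predU1P[<-|f0].
  by rewrite invr0 mulr0 sqrtr_ge0.
by rewrite ler_pdivrMr // electric_congestion_le.
Qed.

End Projection.

(** * Unit demands across edges and lower bounds from potentials *)

Section EdgeDemands.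
Variables (R : realType) (G : graph).

Definition edge_demand (o : orientation G) e : 'cV[R]_(nv G) :=
  chi R (src o e) - chi R (tgt o e).

Lemma gradient_row (o : orientation G) e :
  row e (gradient R o) = (edge_demand o e)^T.
Proof. by rewrite rowK. Qed.

Lemma tr_gradient_delta (o : orientation G) e :
  (gradient R o)^T *m delta_mx e 0 = edge_demand o e.
Proof. by rewrite -colE -tr_row gradient_row trmxK. Qed.

Lemma edge_demand_mulE (o : orientation G) e (p : 'cV[R]_(nv G)) :
  ((edge_demand o e)^T *m p) 0 0 = p (src o e) 0 - p (tgt o e) 0.
Proof.
by rewrite /edge_demand linearB /= mulmxBl /chi !trmx_delta -!rowE !mxE.
Qed.

(** Kirchhoff's current law: a potential drives its drop through each edge. Explicit potentials can
    thus be checked edge by edge. *)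
Lemma laplacian_mulE (o : orientation G) (p : 'cV[R]_(nv G)) :
  laplacian R o *m p =
  \sum_e (p (src o e) 0 - p (tgt o e) 0) *: edge_demand o e.
Proof.
rewrite laplacianE -mulmxA; set q := _ *m p.
rewrite [q]matrix_sum_delta mulmx_sumr; apply: eq_bigr => e _.
rewrite big_ord1 -scalemxAr tr_gradient_delta; congr (_ *: _).
have -> : q e 0 = (row e (gradient R o) *m p) 0 0.
  by rewrite -row_mul [RHS]mxE.
by rewrite gradient_row edge_demand_mulE.
Qed.

Lemma edge_demand_is_demand (o : orientation G) e : is_demand (edge_demand o e).
Proof.
exists 1, (src o e), (tgt o e); split => //; last by rewrite scale1r.
apply/eqP => st; have := card_edge (enum_valP e).
by rewrite (src_tgtE o e) st finset.setUid cards1.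
Qed.

(** Lets demands fixed by one orientation be used under any other: the signs square to 1 and vanish
    from the Laplacian and from absolute loads. *)
Lemma edge_demand_reorient (o o' : orientation G) : exists2 s : 'I_(nedges G) -> R,
  forall e, s e = 1 \/ s e = - 1 & forall e, edge_demand o' e = s e *: edge_demand o e.
Proof.
exists (fun e => if src o' e == src o e then 1 else - 1) => e.
  by case: ifP; [left|right].
have E : [set src o' e; tgt o' e]%SET = [set src o e; tgt o e]%SET.
  by rewrite -!src_tgtE.
have /set2P s'E : src o' e \in [set src o e; tgt o e]%SET by rewrite -E set21.
have /set2P t'E : tgt o' e \in [set src o e; tgt o e]%SET by rewrite -E set22.
have /set2P sE : src o e \in [set src o' e; tgt o' e]%SET by rewrite E set21.
have /set2P tE : tgt o e \in [set src o' e; tgt o' e]%SET by rewrite E set22.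
rewrite /edge_demand; case: eqP => [ss|ns].
  suff -> : tgt o' e = tgt o e by rewrite ss scale1r.
  by case: t'E tE => // -> [] ->.
by case: s'E => // <-; case: sE => [/esym|<-] //; rewrite scaleN1r opprB.
Qed.

(* Unit demands across all edges are routed by unit flows of congestion 1, while
   by symmetry of the electric flow the load they put on [e0] is the total
   amount of the electric flow driven by one unit across [e0]. *)
Lemma edge_demands_ratio_ge (o0 o : orientation G) (p : 'cV[R]_(nv G)) (r : R) e0 :
  0 < r -> laplacian R o0 *m p = r *: edge_demand o0 e0 ->
  (((\sum_e `|p (src o0 e) 0 - p (tgt o0 e) 0|) / r)%:E
     <= competitive_ratio_at o (edge_demand o0))%E.
Proof.
move=> r0 Lp; have [s s1 sE] := edge_demand_reorient o0 o.
have ss e : s e * s e = 1 by have [->|->] := s1 e; rewrite ?mulrNN mulr1.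
have sn e : `|s e| = 1 by have [->|->] := s1 e; rewrite ?normrN normr1.
have lapE : laplacian R o *m p = r *: edge_demand o0 e0.
  rewrite -Lp !laplacian_mulE; apply: eq_bigr => e _.
  rewrite -!edge_demand_mulE sE [(_ *: _)^T]linearZ /= -scalemxAl scalerA [X in X * _]mxE.
  by rewrite mulrAC ss mul1r.
(* One unit along each edge, signed so as to flow from [src o0 e] to [tgt o0 e]. *)
pose f e : 'cV[R]_(nedges G) := s e *: delta_mx e 0.
have fd : routes o f (edge_demand o0).
  by move=> e; rewrite /f -scalemxAr tr_gradient_delta sE scalerA ss scale1r.
have f1 : congestion f = 1.
  have E e : \sum_i `|f i e 0| = 1.
    rewrite (bigD1 e) //= big1 ?addr0 => [|i ie].
      by rewrite !mxE !eqxx mulr1 sn.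
    by rewrite !mxE [e == i]eq_sym (negPf ie) mulr0 normr0.
  rewrite congestionE; apply/le_anti/andP; split.
    by apply: bigmax_le => // e _; rewrite E.
  by rewrite -(E e0); exact: (@le_bigmax _ _ _ _ (fun e => \sum_i `|f i e 0|)).
have electricE e : `|electric_routing o (edge_demand o0 e) e0 0| =
    `|p (src o0 e) 0 - p (tgt o0 e) 0| / r.
  have -> : electric_routing o (edge_demand o0 e) e0 0 =
      (row e0 (electric_routing o (edge_demand o0 e))) 0 0 by rewrite [RHS]mxE.
  rewrite -fd electric_routing_gradient !row_mul gradient_row sE.
  (* Reciprocity: with the demand of [e0] written through [p], the factor [L *m Li] is absorbed by
     [B^T], leaving the drop of [p] across [e]. *)
  have -> : edge_demand o0 e0 = r^-1 *: (laplacian R o *m p).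
    by rewrite lapE scalerA mulVf ?scale1r // gt_eqF.
  rewrite [(_ *: _)^T]linearZ /= [(_ *: _)^T]linearZ /= trmx_mul laplacian_sym.
  rewrite -!scalemxAl -!(mulmxA p^T) laplacian_pseudoinverse_gradient.
  have -> : p^T *m ((gradient R o)^T *m f e) = ((edge_demand o0 e)^T *m p)^T.
    by rewrite trmx_mul trmxK fd.
  rewrite mxE [X in _ * X]mxE [X in _ * (_ * X)]mxE edge_demand_mulE.
  by rewrite !normrM sn mul1r normfV (gtr0_norm r0) mulrC.
apply: (@le_trans _ _ (congestion (fun e => electric_routing o (edge_demand o0 e))
    / congestion f)%:E); last by apply: ereal_sup_ubound; exists f.
rewrite lee_fin f1 divr1 congestionE mulr_suml.
under eq_bigr do rewrite -electricE.
exact: (@le_bigmax _ _ _ _ (fun e0 => \sum_e `|electric_routing o (edge_demand o0 e) e0 0|)).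
Qed.

End EdgeDemands.

(** * Graphs given by a numbered list of ordered pairs *)

Section PairGraph.
Variables (n M : nat) (lo hi : 'I_M -> 'I_n).
Hypothesis lo_lt_hi : forall v, (lo v < hi v)%N.
Hypothesis lo_hi_inj : forall v w, lo v = lo w -> hi v = hi w -> v = w.

Let edge_of v := [set lo v; hi v]%SET.

Lemma pair_graph_card e : e \in [set edge_of v | v : 'I_M]%SET -> #|e| = 2%N.
Proof.
by move=> /imsetP[v _ ->]; rewrite cards2 -(inj_eq val_inj) /= neq_ltn lo_lt_hi.
Qed.

Definition pair_graph := Graph pair_graph_card.

(** Since [lo v < hi v], an unordered pair determines which end is which; matching the ends
    crosswise contradicts the order. *)
Lemma edge_of_inj : injective edge_of.
Proof.
move=> v w E; have := lo_lt_hi v; have := lo_lt_hi w.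
have /set2P loP : lo v \in edge_of w by rewrite -E set21.
have /set2P hiP : hi v \in edge_of w by rewrite -E set22.
by case: loP => a; case: hiP => b; [|move=> _ _; exact: lo_hi_inj| |]; rewrite a b; lia.
Qed.

Lemma nedges_pair_graph : nedges pair_graph = M.
Proof. by rewrite /nedges card_imset ?card_ord //; exact: edge_of_inj. Qed.

Lemma pair_index_ex (e : 'I_(nedges pair_graph)) :
  exists v, enum_val e == edge_of v.
Proof. by have /imsetP[v _ ->] := enum_valP e; exists v. Qed.

(** Translates the numbering of edges by [enum_val] back to the given list of pairs. *)
Definition pair_index e := xchoose (pair_index_ex e).

Lemma pair_indexE e : enum_val e = edge_of (pair_index e) :> {set 'I_n}.
Proof. exact/eqP/(xchooseP (pair_index_ex e)). Qed.

Definition pair_orientation : orientation pair_graph :=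
  @Orientation pair_graph (lo \o pair_index) (hi \o pair_index) pair_indexE.

Lemma pair_index_bij : bijective pair_index.
Proof.
apply: inj_card_bij; last by rewrite !card_ord nedges_pair_graph.
by move=> e e' ee'; apply: enum_val_inj; rewrite !pair_indexE ee'.
Qed.

Lemma adj_pair_graph v : @adj pair_graph (lo v) (hi v).
Proof. by rewrite /adj; apply/imsetP; exists v. Qed.

(** [edge_demands_ratio_ge] carried along the bijection [pair_index], so that potentials are handled
    in the original numbering. *)
Lemma pair_graph_ratio_ge (R : realType) (p : 'I_n -> R) (r : R) (v0 : 'I_M) :
  0 < r ->
  \sum_v (p (lo v) - p (hi v)) *: (@chi R pair_graph (lo v) - @chi R pair_graph (hi v)) =
    r *: (@chi R pair_graph (lo v0) - @chi R pair_graph (hi v0)) ->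
  forall o : orientation pair_graph,
  (((\sum_v `|p (lo v) - p (hi v)|) / r)%:E
    <= competitive_ratio_at o (edge_demand R pair_orientation))%E.
Proof.
move=> r0 Lp o.
have -> : \sum_v `|p (lo v) - p (hi v)| =
    \sum_e `|(\col_i p i) (src pair_orientation e) 0
             - (\col_i p i) (tgt pair_orientation e) 0|.
  rewrite (reindex pair_index) /=; last exact/onW_bij/pair_index_bij.
  by apply: eq_bigr => e _; rewrite !mxE.
have [ix ixK Kix] := pair_index_bij.
apply: (@edge_demands_ratio_ge _ _ _ _ _ _ (ix v0)) => //.
rewrite laplacian_mulE /edge_demand /= Kix -Lp.
rewrite [RHS](reindex pair_index) /=; last exact/onW_bij/pair_index_bij.
by apply: eq_bigr => e _; rewrite !mxE.
Qed.

End PairGraph.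

(** * The lower-bound family: parallel paths closed by one edge *)

Section ParallelPaths.
Variable k : nat.
Let K := k.+1.
Let N := (K * K)%N.

(* [K] parallel paths of [K.+1] edges from [0] to [N.+1]: the [i]-th path runs
   through the vertices congruent to [i] modulo [K] among [1 .. N]. Edge [v.+1]
   joins [v.+1 - K] (truncated at [0]) to [v.+1] (truncated at [N.+1]), and
   edge [0] joins the two ends. *)
Definition path_lo (v : nat) := (v - K)%N.
Definition path_hi (v : nat) := if v == 0%N then N.+1 else minn v N.+1.

Let M := (N + K).+1.

Definition path_src (v : 'I_M) : 'I_N.+2 := inord (path_lo v).
Definition path_tgt (v : 'I_M) : 'I_N.+2 := inord (path_hi v).

Lemma path_srcE v : path_src v = path_lo v :> nat.
Proof. by rewrite inordK // /path_lo; have := ltn_ord v; rewrite /M; lia. Qed.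

Lemma path_tgtE v : path_tgt v = path_hi v :> nat.
Proof. by rewrite inordK // /path_hi; case: ifP => _ //; rewrite ltnS geq_minr. Qed.

Lemma leq_KN : (K <= N)%N. Proof. by rewrite /N leq_pmull. Qed.

Lemma path_src_lt_tgt v : (path_src v < path_tgt v)%N.
Proof.
by rewrite path_srcE path_tgtE /path_lo /path_hi; have := ltn_ord v; have := leq_KN;
  rewrite /M; case: eqP; lia.
Qed.

(** An index above [K] is recovered from its source. Indices up to [K] share source 0 but differ in
    target: [v] itself for [1 <= v <= K], and [N.+1 > K] for [v = 0]. *)
Lemma path_src_tgt_inj v w : path_src v = path_src w -> path_tgt v = path_tgt w -> v = w.
Proof.
move=> /(congr1 val) /= + /(congr1 val) /=; rewrite !path_srcE !path_tgtE /path_lo /path_hi.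
move=> a b; apply/val_inj; move: a b => /=.
by have := leq_KN; case: eqP; case: eqP; lia.
Qed.

Definition parallel_paths := pair_graph path_src_lt_tgt.

Lemma nedges_parallel_paths : nedges parallel_paths = M.
Proof. exact: nedges_pair_graph path_src_tgt_inj. Qed.

(** Each vertex [u > 0] is the target of edge number [u], whose source is smaller; strong induction
    links every vertex to 0. *)
Lemma parallel_paths_connected : connected_graph parallel_paths.
Proof.
have sym : connect_sym (@adj parallel_paths).
  by apply: sym_connect_sym => u v; rewrite /adj finset.setUC.
have H (u : 'I_N.+2) : connect (@adj parallel_paths) ord0 u.
  have [m] := ubnP (u : nat); elim: m u => // m IH u um.
  case: (posnP u) => [u0|u0]; first by have -> : u = ord0 by exact/val_inj.
  have uM : (u < M)%N by have := ltn_ord u; rewrite /M /K; lia.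
  pose v := Ordinal uM.
  have vu : path_tgt v = u.
    by apply/val_inj; rewrite /= path_tgtE /path_hi /=; have := ltn_ord u; case: eqP; lia.
  apply: (connect_trans (IH (path_src v) _)).
    by rewrite path_srcE /path_lo /= /K; lia.
  by apply: connect1; rewrite -[X in adj _ X]vu; exact: adj_pair_graph.
by split=> // u v; apply: (connect_trans _ (H v)); rewrite sym.
Qed.

(** The ceiling of [u / K], that is, the number of path edges from 0 to [u]; the far end [N.+1] lies
    in layer [K.+1]. *)
Definition layer (u : nat) := ((u + k) %/ K)%N.

(** Three ranges of [v]: edges leaving 0, later edges whose target [v] is not truncated, and edges
    whose target is truncated to [N.+1]; sources of the last kind lie in layer [K]. *)
Lemma layer_step v : (0 < v < M)%N -> layer (path_hi v) = (layer (path_lo v)).+1.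
Proof.
rewrite /layer /path_hi /path_lo /M => /andP[v0 vM]; rewrite gtn_eqF //.
have [vK|Kv] := leqP v K.
  have -> : (v - K = 0)%N by lia.
  have -> : minn v N.+1 = v by have := leq_KN; lia.
  rewrite [((0 + k) %/ K)%N]divn_small //.
  have -> : (v + k = v.-1 + K)%N by rewrite /K; lia.
  by rewrite divnDr ?dvdnn // divnn /= divn_small // /K; lia.
have [vN|Nv] := leqP v N.+1.
  have -> : (v + k = (v - K + k) + K)%N by lia.
  by rewrite divnDr ?dvdnn // divnn addn1.
have -> : (N.+1 + k = K * K + K)%N by rewrite /N /K; lia.
have -> : (v - K + k = K * K + (v - N.+1))%N by rewrite -/N; move: Kv Nv; rewrite /K; lia.
rewrite !divnDl ?dvdn_mulr // divnn mulnK //= addn1.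
by rewrite [((v - _) %/ _)%N]divn_small ?addn0 //; lia.
Qed.

(** Each inner vertex is once a source and once a target of a path edge, so only the two ends
    survive, [K] times each. With [c] the indicator vectors, this is the net demand of a unit
    current on every path. *)
Lemma parallel_paths_flow (V : zmodType) (c : nat -> V) :
  \sum_(0 <= v < N + K) (c (path_lo v.+1) - c (path_hi v.+1)) = (c 0%N - c N.+1) *+ K.
Proof.
have sum_lo : \sum_(0 <= v < N + K) c (path_lo v.+1) =
    c 0%N *+ K + \sum_(0 <= v < N) c v.+1.
  rewrite (big_cat_nat _ (leq_addl N K)) //=; congr (_ + _).
    rewrite -[in RHS](subn0 K) -sumr_const_nat; apply: eq_big_nat => v vK.
    by congr c; rewrite /path_lo; lia.
  rewrite -{1}[K]add0n big_addn addnK; apply: eq_bigr => v _.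
  by congr c; rewrite /path_lo; lia.
have sum_hi : \sum_(0 <= v < N + K) c (path_hi v.+1) =
    \sum_(0 <= v < N) c v.+1 + c N.+1 *+ K.
  rewrite (big_cat_nat _ (leq_addr K N)) //=; congr (_ + _).
    by apply: eq_big_nat => v vN; congr c; rewrite /path_hi /=; lia.
  rewrite -[in RHS](addKn N K) -sumr_const_nat; apply: eq_big_nat => v vN.
  by congr c; rewrite /path_hi /=; lia.
by rewrite sumrB sum_lo sum_hi opprD addrA addrK mulrnBl.
Qed.

Lemma parallel_paths_ratio_ge (R : realType) :
  exists (l : nat) (d : 'I_l -> 'cV[R]_(nv parallel_paths)),
    is_demand_set d /\ forall o : orientation parallel_paths,
      ((2^-1 * Num.sqrt (nedges parallel_paths)%:R)%:E <= competitive_ratio_at o d)%E.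
Proof.
exists (nedges parallel_paths), (edge_demand R (pair_orientation path_src_lt_tgt)).
split=> [e|o]; first exact: edge_demand_is_demand.
(* This potential drops by 1 along each path edge and by [K.+1] across edge 0. *)
pose p (u : 'I_N.+2) : R := - (layer u)%:R.
have p0 : p (path_src ord0) - p (path_tgt ord0) = K.+1%:R.
  rewrite /p path_srcE path_tgtE /path_lo /path_hi /= sub0n /layer add0n divn_small //.
  have -> : (N.+1 + k = K * K + K)%N by rewrite /N /K; lia.
  by rewrite divnDr ?dvdnn // mulnK // divnn oppr0 add0r opprK addn1.
have pS (v : 'I_(N + K)) : p (path_src (lift ord0 v)) - p (path_tgt (lift ord0 v)) = 1.
  rewrite /p path_srcE path_tgtE /= /bump /= add1n layer_step; last by rewrite /= ltnS.
  by rewrite opprK -natr1 addKr.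
(* The total current [K.+1 + K] is the [K.+1] units on edge 0 plus one unit on each of the [K]
   paths. *)
apply: (le_trans _ (@pair_graph_ratio_ge _ _ _ _ path_src_lt_tgt path_src_tgt_inj R p
  (K.+1 + K)%:R ord0 _ _ o)); last 2 first.
- by rewrite ltr0n.
- rewrite big_ord_recl p0 [in RHS]natrD [RHS]scalerDl; apply: congr1.
  under eq_bigr do rewrite pS scale1r.
  have := parallel_paths_flow (fun j => @chi R parallel_paths (inord j)).
  rewrite big_mkord -scaler_nat => flow.
  by rewrite -[RHS]flow.
rewrite lee_fin nedges_parallel_paths.
have Mle : M%:R <= \sum_v `|p (path_src v) - p (path_tgt v)|.
  rewrite big_ord_recl p0; under eq_bigr do rewrite pS normr1.
  by rewrite sumr_const card_ord normr_nat -natrD ler_nat /M; lia.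
rewrite ler_pdivlMr ?ltr0n //; apply: le_trans Mle.
set t := Num.sqrt _; have t0 : 0 <= t by exact: sqrtr_ge0.
have tt : M%:R = t ^+ 2 by rewrite sqr_sqrtr.
(* Squared, this reads [4K^2 + 4K + 1 <= 4 (K^2 + K + 1)]; it yields the constant [2^-1]. *)
have Kt : (K.+1 + K)%:R <= 2 * t.
  rewrite -ler_sqr ?nnegrE ?mulr_ge0 // exprMn -tt -!natrX -natrM ler_nat.
  by rewrite /M /N; nia.
by rewrite tt; move: Kt; move: (_%:R) => x; nra.
Qed.

End ParallelPaths.

(** * Both bounds combined *)

Theorem theorem2 (R : realType) :
  (exists2 C : R, 0 < C &
     forall (G : graph) (o : orientation G), connected_graph G ->
       (competitive_ratio R o <= (C * Num.sqrt (nedges G)%:R)%:E)%E)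
  /\
  (exists2 c : R, 0 < c &
     exists G : nat -> graph,
       [/\ forall k, connected_graph (G k),
           nedges (G k) @[k --> \oo] --> \oo,
           forall (k : nat) (o : orientation (G k)),
             ((c * Num.sqrt (nedges (G k))%:R)%:E <= competitive_ratio R o)%E
         & forall k : nat,
             exists (l : nat) (d : 'I_l -> 'cV[R]_(nv (G k))),
               is_demand_set d /\
               forall o : orientation (G k),
                 ((c * Num.sqrt (nedges (G k))%:R)%:E
                    <= competitive_ratio_at o d)%E]).
Proof.
split.
  exists 1 => // G o _; rewrite mul1r; exact: competitive_ratio_le.
exists 2^-1; first by rewrite invr_gt0.
exists parallel_paths; split => [k||k o|k].
- exact: parallel_paths_connected.
- apply/cvgnyPge => A; near=> k; rewrite nedges_parallel_paths.
  (* The number of edges, [K^2 + K + 1] with [K = k.+1], exceeds [k]. *)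
  suff : (A <= k)%N by nia.
  by near: k; exact: nbhs_infty_ge.
- have [l [d [dd dle]]] := parallel_paths_ratio_ge k R.
  by apply: le_trans (dle o) _; apply: ereal_sup_ubound; exists l, d.
- exact: parallel_paths_ratio_ge.
Unshelve. all: by end_near. Qed.
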